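(* Let $n\ge 3$ and let $\mathbf{a}=(a_1,\dots,a_r)$ be a sequence of positive integers with $\sum_{i=1}^r a_i=n$. Then the matching field ideal $M_{\mathbf{a}}\subset K[x_1,\dots,x_n,y_1,\dots,y_n,z_1,\dots,z_n]$ has the linear quotient property with respect to the block ordering $\prec_{\mathbf{a}}$ of its generators; that is, if $m_1\prec_{\mathbf{a}} m_2\prec_{\mathbf{a}}\cdots\prec_{\mathbf{a}} m_N$ are the monomial generators of $M_{\mathbf{a}}$ listed in this order, then for each $j$ the colon ideal $\langle m_1,\dots,m_{j-1}\rangle : m_j$ is generated by a subset of the variables.
   Context: $K$ is a field. Put $\alpha_0=0$, $\alpha_t=\sum_{i=1}^t a_i$, and $I_t=\{\alpha_{t-1}+1,\dots,\alpha_t\}$ for $1\le t\le r$. Matching field ideal: for every $3$-subset $\{i<j<k\}$ of $[n]=\{1,\dots,n\}$ let $s$ be the minimal $t$ such that $I_t\cap\{i,j,k\}\ne\emptyset$, and set $$m_{\{ijk\}}=\begin{cases} x_jy_iz_k & \text{if } |\{i,j,k\}\cap I_s|=1,\\ x_iy_jz_k&\text{otherwise.}\end{cases}$$ $M_{\mathbf{a}}$ is the ideal generated by the monomials $m_{\{ijk\}}$ for all $3$-subsets of $[n]$; its generators are these $\binom{n}{3}$ monomials. Block ordering: write $(i,j,k)$ for the monomial $x_iy_jz_k$. For generators $(i,j,k)$ and $(\ell,u,v)$ of $M_{\mathbf{a}}$ with $j\in I_s$ and $u\in I_t$, one has $(i,j,k)\prec_{\mathbf{a}}(\ell,u,v)$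 if and only if one of the following holds: $k>v$; or $k=v$ and $s<t$; or $k=v$, $s=t$ and $j>u$; or $k=v$, $s=t$, $j=u$ and $i<\ell$. A generator that is smaller with respect to $\prec_{\mathbf{a}}$ comes earlier in the list. *)

(* Defs.v *)
From mathcomp Require Import all_boot all_order all_algebra.
From mathcomp Require Import mpoly zify.

Set Implicit Arguments.
Unset Strict Implicit.
Unset Printing Implicit Defensive.

Import GRing.Theory.
Local Open Scope ring_scope.

Definition ideal_of (R : comNzRingType) (s : seq R) (f : R) : Prop :=
  exists c : 'I_(size s) -> R, f = \sum_(i < size s) c i * s`_i.

Definition colon (R : comNzRingType) (I : R -> Prop) (m f : R) : Prop :=
  I (f * m).

Definition generated_by_variables (N : nat) (R : comNzRingType)
    (I : {mpoly R[N]} -> Prop) : Prop :=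
  exists V : {set 'I_N}, forall f, I f <-> ideal_of [seq 'X_v | v <- enum V] f.

(** [I] has linear quotients with respect to the list [ms] of its generators.
    Indices start at 0, so [take j ms] consists of the generators preceding
    the one at position [j]. *)
Definition has_linear_quotients (N : nat) (R : comNzRingType)
    (I : {mpoly R[N]} -> Prop) (ms : seq {mpoly R[N]}) : Prop :=
  (forall f, I f <-> ideal_of ms f) /\
  (forall j, (j < size ms)%N ->
     generated_by_variables (colon (ideal_of (take j ms)) ms`_j)).

(** The 3n variables, in the order x_1..x_n, y_1..y_n, z_1..z_n; the index
    [i : 'I_n] stands for the element i + 1 of {1, ..., n}. *)

Definition xvar (K : fieldType) n (i : 'I_n) : {mpoly K[n + n + n]} :=
  'X_(lshift n (lshift n i)).
Definition yvar (K : fieldType) n (i : 'I_n) : {mpoly K[n + n + n]} :=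
  'X_(lshift n (rshift n i)).
Definition zvar (K : fieldType) n (i : 'I_n) : {mpoly K[n + n + n]} :=
  'X_(rshift (n + n) i).

Notation triple n := ('I_n * 'I_n * 'I_n)%type.

(** The triple (i, j, k) encodes the monomial x_i y_j z_k. *)
Definition monom (K : fieldType) n (p : triple n) : {mpoly K[n + n + n]} :=
  let: (i, j, k) := p in xvar K i * yvar K j * zvar K k.

Definition alpha (a : seq nat) (t : nat) : nat := sumn (take t a).

(** With indices and blocks both counted from 0, [block n a t] is
    I_(t+1) = {alpha_t + 1, ..., alpha_(t+1)}. *)
Definition block n (a : seq nat) (t : nat) : {set 'I_n} :=
  [set i : 'I_n | (alpha a t <= i < alpha a t.+1)%N].

(** The minimal t such that the t-th block meets A ([find] on [iota 0 _]
    returns the value t itself, or [size a] if there is none). *)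
Definition first_block n (a : seq nat) (A : {set 'I_n}) : nat :=
  find (fun t => block n a t :&: A != set0) (iota 0 (size a)).

(** The monomial m_{ijk}, meaningful for i < j < k. *)
Definition matching_triple n (a : seq nat) (i j k : 'I_n) : triple n :=
  let A := [set i; j; k] in
  if #|A :&: block n a (first_block a A)| == 1%N then (j, i, k) else (i, j, k).

Definition matching_gens n (a : seq nat) : {set triple n} :=
  [set matching_triple a e.1.1 e.1.2 e.2 | e : triple n
     & (e.1.1 < e.1.2)%N && (e.1.2 < e.2)%N].

Definition matching_field_ideal (K : fieldType) n (a : seq nat) :
    {mpoly K[n + n + n]} -> Prop :=
  ideal_of [seq monom K p | p <- enum (matching_gens n a)].

(** The block ordering: [block_lt a p q] means that p comes before q. *)
Definition block_lt n (a : seq nat) : rel (triple n) := fun p q =>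
  let: (i, j, k) := p in
  let: (l, u, v) := q in
  [exists s : 'I_(size a), exists t : 'I_(size a),
    [&& j \in block n a s, u \in block n a t &
     [|| (k > v)%N,
         (k == v) && (s < t)%N,
         [&& k == v, s == t & (j > u)%N] |
         [&& k == v, s == t, j == u & (i < l)%N]]]].

Definition block_listing n (a : seq nat) (ms : seq (triple n)) : Prop :=
  perm_eq ms (enum (matching_gens n a)) /\ sorted (block_lt a) ms.

(** The block ordering is a strict total order on triples, hence there is
    exactly one listing. *)

Lemma alpha_exists (a : seq nat) m : (m < sumn a)%N ->
  exists2 t, (t < size a)%N & (alpha a t <= m < alpha a t.+1)%N.
Proof.
rewrite /alpha; elim: a m => [|b a IHa] m //=.
have [lt_mb _ | le_bm lt_m] := ltnP m b.
  by exists 0%N => //=; rewrite take0 /= addn0.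
have [|t lt_t /andP[le1 lt2]] := IHa (m - b)%N; first by lia.
by exists t.+1 => //=; apply/andP; split; lia.
Qed.

Lemma alpha_mono (a : seq nat) s t : (s <= t)%N -> (alpha a s <= alpha a t)%N.
Proof.
move=> le_st; rewrite /alpha -(subnKC le_st) takeD sumn_cat; exact: leq_addr.
Qed.

Lemma block_uniq n (a : seq nat) (i : 'I_n) s t :
  i \in block n a s -> i \in block n a t -> s = t.
Proof.
rewrite !inE => /andP[s1 s2] /andP[t1 t2].
have [lt_st | lt_ts | //] := ltngtP s t.
  by have := alpha_mono a lt_st; lia.
by have := alpha_mono a lt_ts; lia.
Qed.

Lemma block_ltE n (a : seq nat) : sumn a = n ->
  exists b : 'I_n -> nat, forall i j k l u v : 'I_n,
    block_lt a (i, j, k) (l, u, v) =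
    [|| (k > v)%N,
        (k == v :> nat) && (b j < b u)%N,
        [&& k == v :> nat, b j == b u & (j > u)%N] |
        [&& k == v :> nat, b j == b u, j == u :> nat & (i < l)%N]].
Proof.
move=> sum_a; have ex (i : 'I_n) : exists t : 'I_(size a), i \in block n a t.
  have lt_i : (i < sumn a)%N by rewrite sum_a.
  have [t lt_t bt] := alpha_exists lt_i.
  by exists (Ordinal lt_t); rewrite inE.
exists (fun i => val (xchoose (ex i))) => i j k l u v.
apply/existsP/idP => [[s /existsP[t /and3P[js ut h]]]|h].
  by rewrite /= (block_uniq (xchooseP (ex j)) js) (block_uniq (xchooseP (ex u)) ut).
exists (xchoose (ex j)); apply/existsP; exists (xchoose (ex u)).
by apply/and3P; split; [exact: (xchooseP (ex j)) | exact: (xchooseP (ex u)) |].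
Qed.

Lemma block_lt_irr n (a : seq nat) : sumn a = n -> irreflexive (@block_lt n a).
Proof. by case/block_ltE=> b bE [[i j] k]; rewrite bE; lia. Qed.

Lemma block_lt_trans n (a : seq nat) : sumn a = n -> transitive (@block_lt n a).
Proof.
case/block_ltE=> b bE [[i j] k] [[l u] v] [[x y] z]; rewrite !bE; lia.
Qed.

Lemma block_lt_total n (a : seq nat) (p q : triple n) : sumn a = n ->
  p != q -> block_lt a p q || block_lt a q p.
Proof.
case/block_ltE=> b bE; case: p q => [[i j] k] [[l u] v].
rewrite !bE !xpair_eqE -!val_eqE /= => neq.
have [eq_ju|] := eqVneq j u; last by rewrite -val_eqE /=; lia.
by subst u; lia.
Qed.

Lemma block_listing_exists n (a : seq nat) : sumn a = n ->
  exists ms : seq (triple n), block_listing a ms.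
Proof.
move=> sum_a; pose le p q := (p == q) || @block_lt n a p q.
have le_total : total le.
  move=> p q; rewrite /le; have [-> | neq] := eqVneq p q; first by [].
  by rewrite (block_lt_total sum_a neq).
have le_trans : transitive le.
  move=> q p r; rewrite /le => /orP[/eqP-> // | pq] /orP[/eqP<- | qr].
    by rewrite pq orbT.
  by rewrite (block_lt_trans sum_a pq qr) orbT.
pose ms := sort le (enum (matching_gens n a)).
have ms_perm : perm_eq ms (enum (matching_gens n a)) by rewrite perm_sort.
exists ms; split=> //.
have : sorted le ms by exact: sort_sorted.
have : uniq ms by rewrite (perm_uniq ms_perm) enum_uniq.
rewrite (sorted_pairwise le_trans) (sorted_pairwise (block_lt_trans sum_a)).
rewrite uniq_pairwise => ms_uniq ms_le.
have := conj ms_uniq ms_le => /andP; rewrite -pairwise_relI.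
by apply: sub_pairwise => p q /andP[/= /negPf pq]; rewrite /le pq.
Qed.

Lemma block_listing_unique n (a : seq nat) (ms ms' : seq (triple n)) :
  sumn a = n -> block_listing a ms -> block_listing a ms' -> ms = ms'.
Proof.
move=> sum_a [ms_perm ms_lt] [ms'_perm ms'_lt].
apply: (irr_sorted_eq (block_lt_trans sum_a) (block_lt_irr sum_a)) => // p.
by rewrite (perm_mem ms_perm) (perm_mem ms'_perm).
Qed.

(* Main.v *)
Require Import Defs.
From mathcomp Require Import all_boot all_order all_algebra.
From mathcomp Require Import mpoly zify.

(** The monomial x_p y_q z_k is a generator of the matching field ideal exactly
    when p and q are smaller than k and p comes before q in the total order
    [swapped_lt] on indices, which lists the blocks from last to first and each
    block in increasing order ([mem_matching_gens]).  In these terms the block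
    ordering sorts generators by decreasing k, then by q from last to first
    for [swapped_lt], then by increasing p.

    Linear quotients for a list of monomials means that whenever e precedes m,
    some e' that also precedes m satisfies e' / gcd(e', m) = X_v for a variable
    X_v dividing e / gcd(e, m) ([colon_generated_by_variables]).  If x_l y_u z_v
    precedes x_p y_q z_k, such an e' arises by changing a single index of
    (p, q, k) ([block_lt_exchange]):
    - if v > k, take (p, q, v), since p and q are still smaller than v;
    - if v = k and u comes after q, take (p, u, k), since p, being before q, is
      also before u;
    - if v = k, u = q and l < p, take (l, q, k), the given generator.
    The variable is z_v, y_u or x_l respectively. *)

Set Implicit Arguments.
Unset Strict Implicit.
Unset Printing Implicit Defensive.

Import GRing.Theory.
Local Open Scope ring_scope.

(** * Finitely generated ideals *)

Section Ideals.
Variable R : comNzRingType.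
Implicit Types (s t : seq R) (f g : R).

Lemma ideal_of0 s : ideal_of s 0.
Proof. by exists (fun=> 0); rewrite big1 // => i _; rewrite mul0r. Qed.

Lemma ideal_ofD s f g : ideal_of s f -> ideal_of s g -> ideal_of s (f + g).
Proof.
move=> [c ->] [d ->]; exists (fun i => c i + d i).
by rewrite -big_split; apply: eq_bigr => i _; rewrite mulrDl.
Qed.

Lemma ideal_ofM s f g : ideal_of s f -> ideal_of s (g * f).
Proof.
move=> [c ->]; exists (fun i => g * c i).
by rewrite mulr_sumr; apply: eq_bigr => i _; rewrite mulrA.
Qed.

Lemma ideal_of_sum (I : eqType) (r : seq I) (F : I -> R) s :
  (forall i, i \in r -> ideal_of s (F i)) -> ideal_of s (\sum_(i <- r) F i).
Proof.
move=> sF; rewrite big_seq; apply: big_ind => //; first exact: ideal_of0.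
by move=> f g; apply: ideal_ofD.
Qed.

Lemma mem_ideal_of s f : f \in s -> ideal_of s f.
Proof.
rewrite -index_mem => lt_f; exists (fun i => (i == Ordinal lt_f)%:R).
rewrite (bigD1 (Ordinal lt_f)) //= eqxx mul1r nth_index -?index_mem //.
by rewrite big1 ?addr0 // => i /negPf->; rewrite mul0r.
Qed.

Lemma ideal_of_min s t f :
  (forall g, g \in s -> ideal_of t g) -> ideal_of s f -> ideal_of t f.
Proof.
move=> st [c ->]; apply: ideal_of_sum => i _.
by apply: ideal_ofM; apply: st; rewrite mem_nth.
Qed.

Lemma eq_ideal_of s t f : s =i t -> ideal_of s f <-> ideal_of t f.
Proof.
by move=> st; split; apply: ideal_of_min => g gs; apply: mem_ideal_of;
  rewrite ?st // -st.
Qed.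

End Ideals.

(** * Colon ideals of monomial ideals *)

Section MonomialIdeals.
Variables (N : nat) (R : comNzRingType).
Implicit Types (E : seq 'X_{1..N}) (m e : 'X_{1..N}) (f : {mpoly R[N]}).

Lemma ideal_of_mpolyX E m e :
  e \in E -> (e <= m)%MM -> ideal_of [seq 'X_[R, e'] | e' <- E] 'X_[m].
Proof.
move=> eE /submK <-; rewrite mpolyXD; apply: ideal_ofM.
by apply: mem_ideal_of; apply: map_f.
Qed.

(** A monomial of a combination of the X^e is a monomial of some c_e X^e, hence
    a multiple of X^e. *)
Lemma ideal_of_msupp E f m : ideal_of [seq 'X_[R, e] | e <- E] f ->
  m \in msupp f -> exists2 e, e \in E & (e <= m)%MM.
Proof.
move=> [c ->]; rewrite mcoeff_msupp => m_f.
have [/hasP[e eE em]|/hasPn noE] := boolP (has (fun e => (e <= m)%MM) E).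
  by exists e.
case/eqP: m_f; rewrite raddf_sum /= big1 // => i _.
have lt_i : (i < size E)%N by rewrite -(size_map (fun e => 'X_[R, e])).
rewrite (nth_map 0%MM) //; apply/eqP; rewrite mcoeff_eq0.
rewrite (perm_mem (msuppMX _ _)); apply/mapP=> -[m' _ def_m].
by move/negP: (noE _ (mem_nth 0%MM lt_i)); rewrite {1}def_m lem_addr.
Qed.

(** Colon ideals of monomial ideals are monomial, so only a monomial X^m' with
    X^m' X^m divisible by some X^e matters; the variable v provided for e then
    divides X^m'. *)
Lemma colon_generated_by_variables E m :
  (forall e, e \in E -> exists v : 'I_N, (m v < e v)%N /\
     exists2 e', e' \in E & (e' <= U_(v) + m)%MM) ->
  generated_by_variables (colon (ideal_of [seq 'X_[R, e] | e <- E]) 'X_[m]).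
Proof.
move=> exch; exists [set v : 'I_N | has (fun e => (e <= U_(v) + m)%MM) E] => f.
split=> [Ifm | ].
  rewrite [f]mpolyE; apply: ideal_of_sum => m' m'f.
  have : (m + m')%MM \in msupp (f * 'X_[m]).
    by rewrite (perm_mem (msuppMX _ _)) map_f.
  case/(ideal_of_msupp Ifm) => e /exch[v [lt_v [e' e'E le_e']]] /mnm_lepP/(_ v).
  rewrite mnmDE => le_v.
  have /submK <- : (U_(v) <= m')%MM by rewrite lep1mP; lia.
  rewrite mpolyXD -mul_mpolyC; do 2!apply: ideal_ofM.
  apply: mem_ideal_of; apply/mapP; exists v => //.
  by rewrite mem_enum inE; apply/hasP; exists e'.
move=> [c ->]; rewrite /colon mulr_suml; apply: ideal_of_sum => i _.
rewrite -mulrA; apply: ideal_ofM.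
have /mapP[v] := mem_nth 0 (ltn_ord i).
rewrite mem_enum inE => /hasP[e eE le_e] ->.
by rewrite -mpolyXD; apply: ideal_of_mpolyX le_e.
Qed.

End MonomialIdeals.

(** * Generators of the matching field ideal *)

(** The block of a single index, obtained as the first block that meets its
    singleton. *)
Definition block_of n (a : seq nat) (i : 'I_n) : nat := first_block a [set i].

Definition swapped_lt n (a : seq nat) : rel 'I_n := fun p q =>
  (block_of a q < block_of a p)%N ||
  (block_of a q == block_of a p) && (p < q)%N.

Lemma swapped_lt_trans n (a : seq nat) : transitive (@swapped_lt n a).
Proof. by move=> q p u; rewrite /swapped_lt; lia. Qed.

Section Blocks.
Variables (n : nat) (a : seq nat).
Hypothesis a_sum : sumn a = n.
Implicit Types (A : {set 'I_n}) (i j k p q : 'I_n).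

Lemma exists_block i : exists2 t, (t < size a)%N & i \in block n a t.
Proof.
have [|t lt_t it] := @alpha_exists a i; first by rewrite a_sum.
by exists t; rewrite ?inE.
Qed.

Lemma first_block_spec A i : i \in A ->
  (first_block a A < size a)%N /\
  (exists2 j, j \in A & j \in block n a (first_block a A)).
Proof.
move=> iA; have [t lt_t it] := exists_block i.
have : has (fun t => block n a t :&: A != set0) (iota 0 (size a)).
  by apply/hasP; exists t; rewrite ?mem_iota //; apply/set0Pn; exists i;
    rewrite in_setI it.
move=> hasA; have := hasA; rewrite has_find size_iota => lt_f; split=> //.
have := nth_find 0%N hasA; rewrite nth_iota // add0n.
by case/set0Pn => j; rewrite in_setI => /andP[]; exists j.
Qed.

Lemma block_of_lt i : (block_of a i < size a)%N.
Proof. by case: (first_block_spec (set11 i)). Qed.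

Lemma mem_block_of i : i \in block n a (block_of a i).
Proof. by case: (first_block_spec (set11 i)) => _ [j /set1P->]. Qed.

Lemma mem_blockE i t : (i \in block n a t) = (block_of a i == t).
Proof.
apply/idP/eqP => [it | <-]; last exact: mem_block_of.
exact: block_uniq (mem_block_of i) it.
Qed.

Lemma block_of_mono i j : (i <= j)%N -> (block_of a i <= block_of a j)%N.
Proof.
move=> le_ij; rewrite leqNgt; apply/negP => /(@alpha_mono a).
by have := mem_block_of i; have := mem_block_of j; rewrite !inE; lia.
Qed.

Lemma first_block_min A i : i \in A -> (forall j, j \in A -> (i <= j)%N) ->
  first_block a A = block_of a i.
Proof.
move=> iA minA; have [lt_f [j jA]] := first_block_spec iA.
rewrite mem_blockE => /eqP def_f; apply/eqP; rewrite eqn_leq -{2}def_f.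
rewrite block_of_mono ?minA // andbT leqNgt; apply/negP => lt_i.
have := before_find 0%N lt_i; rewrite nth_iota ?block_of_lt // add0n.
by move/negbFE/eqP/setP/(_ i); rewrite !in_setI mem_block_of iA inE.
Qed.

Lemma matching_tripleE i j k : (i < j)%N -> (j < k)%N ->
  matching_triple a i j k =
    if (block_of a i < block_of a j)%N then (j, i, k) else (i, j, k).
Proof.
move=> lt_ij lt_jk; rewrite /matching_triple (@first_block_min _ i); first last.
- by move=> x; rewrite !inE => /orP[/orP[]|] /eqP->; lia.
- by rewrite !inE eqxx.
set A := _ :&: _; have iA : i \in A by rewrite !in_setI mem_block_of !inE eqxx.
have [lt_b | le_b] := ltnP.
  suff -> : A = [set i] by rewrite cards1.
  apply/setP => x; apply/idP/set1P => [|-> //].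
  have := block_of_mono (ltnW lt_jk).
  by rewrite in_setI mem_blockE !inE => le_jk /andP[/orP[/orP[]|] /eqP->] //; lia.
case: ifP => // /cards1P[x Ax].
have : j \in A.
  by rewrite in_setI mem_blockE eqn_leq le_b block_of_mono ?(ltnW lt_ij) // !inE
    eqxx orbT.
by move: iA; rewrite Ax !inE => /eqP ix /eqP jx; move: lt_ij; rewrite ix jx ltnn.
Qed.

(** For i < j the blocks of i and j are weakly increasing.  If they differ, x
    and y are swapped, so that x gets the index in the later block; if they
    agree, x keeps the smaller index.  Both cases put the x-index first for
    [swapped_lt]. *)
Lemma mem_matching_gens p q k :
  ((p, q, k) \in matching_gens n a) =
  [&& (p < k)%N, (q < k)%N & swapped_lt a p q].
Proof.
apply/imsetP/idP => [[[[i j] l]]|].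
  rewrite inE /= => /andP[lt_ij lt_jl]; rewrite matching_tripleE //.
  have := block_of_mono (ltnW lt_ij).
  by rewrite /swapped_lt; case: ltnP => ? ? [-> -> ->]; lia.
rewrite /swapped_lt => /and3P[lt_pk lt_qk /orP[lt_b | /andP[/eqP eq_b lt_pq]]].
  have lt_qp : (q < p)%N.
    by rewrite ltnNge; apply/negP => /block_of_mono; rewrite leqNgt lt_b.
  by exists (q, p, k); rewrite ?inE /= ?lt_qp // matching_tripleE // lt_b.
by exists (p, q, k); rewrite ?inE /= ?lt_pq // matching_tripleE // eq_b ltnn.
Qed.

(** * The block ordering and its exchange property *)

(** The block ordering compares y-indices by increasing block and, inside a
    block, by decreasing index: this is the converse of [swapped_lt]. *)
Lemma block_lt_swapped (p q k l u v : 'I_n) :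
  block_lt a (l, u, v) (p, q, k) =
  [|| (k < v)%N, (v == k) && swapped_lt a q u |
      [&& v == k, u == q & (l < p)%N]].
Proof.
have same_block : u == q :> nat -> block_of a u == block_of a q.
  by move/eqP/val_inj->.
apply/existsP/idP => [[s /existsP[t]]|].
  rewrite !mem_blockE /swapped_lt -!val_eqE /= => /and3P[/eqP <- /eqP <-].
  by move: same_block; lia.
move=> before; exists (Ordinal (block_of_lt u)).
apply/existsP; exists (Ordinal (block_of_lt q)).
rewrite !mem_block_of; move: before same_block.
by rewrite /swapped_lt -!val_eqE /=; lia.
Qed.

End Blocks.

Definition exponent n (p : triple n) : 'X_{1..n + n + n} :=
  (U_(lshift n (lshift n p.1.1)) + U_(lshift n (rshift n p.1.2))
   + U_(rshift (n + n) p.2))%MM.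

Lemma monomE (K : fieldType) n (p : triple n) : monom K p = 'X_[exponent p].
Proof. by case: p => [[i j] k]; rewrite /exponent !mpolyXD. Qed.

(** Replacing the z-index, the y-index or the x-index of m by that of e, at the
    first of these positions where they differ, gives e'. *)
Lemma block_lt_exchange n (a : seq nat) (e m : triple n) : sumn a = n ->
  e \in matching_gens n a -> m \in matching_gens n a -> block_lt a e m ->
  exists v : 'I_(n + n + n), (exponent m v < exponent e v)%N /\
    exists2 e' : triple n, (e' \in matching_gens n a) && block_lt a e' m &
      (exponent e' <= U_(v) + exponent m)%MM.
Proof.
move=> a_sum; case: e m => [[l u] v] [[p q] k].
rewrite !mem_matching_gens // block_lt_swapped //.
move=> /and3P[lt_lv lt_uv lu] /and3P[lt_pk lt_qk pq].
case/or3P=> [lt_kv | /andP[/eqP eq_vk qu] | /and3P[/eqP eq_vk /eqP eq_uq lt_lp]].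
- exists (rshift (n + n) v); split.
    rewrite /exponent !mnmDE !mnm1E !eq_shift eqxx /=.
    by case: eqVneq lt_kv => [->|//]; rewrite ltnn.
  exists (p, q, v); last by apply/mnm_lepP => i; rewrite /exponent /= !mnmDE; lia.
  rewrite mem_matching_gens // block_lt_swapped // lt_kv pq.
  by rewrite !(ltn_trans _ lt_kv).
- subst v; exists (lshift n (rshift n u)); split.
    rewrite /exponent !mnmDE !mnm1E !eq_shift eqxx /=.
    by case: eqVneq qu => [->|//]; rewrite /swapped_lt !ltnn andbF.
  exists (p, u, k); last by apply/mnm_lepP => i; rewrite /exponent /= !mnmDE; lia.
  rewrite mem_matching_gens // block_lt_swapped // lt_pk lt_uv qu eqxx orbT.
  by rewrite (swapped_lt_trans pq qu).
subst u v; exists (lshift n (lshift n l)); split.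
  rewrite /exponent !mnmDE !mnm1E !eq_shift eqxx /=.
  by case: eqVneq lt_lp => [->|//]; rewrite ltnn.
exists (l, q, k); last by apply/mnm_lepP => i; rewrite /exponent /= !mnmDE; lia.
by rewrite mem_matching_gens // block_lt_swapped // lt_lv lt_uv lu !eqxx lt_lp !orbT.
Qed.

(** In a list sorted by a strict order the position of an entry is determined
    by comparison, which turns the ideals spanned by initial segments into
    ideals spanned by all smaller generators. *)
Lemma mem_take_sorted (T : eqType) (lt : rel T) (s : seq T) x0 j y :
  irreflexive lt -> transitive lt -> sorted lt s -> (j < size s)%N ->
  (y \in take j s) = (y \in s) && lt y (nth x0 s j).
Proof.
move=> lt_irr lt_trans lt_s lt_j; have ltn_lt := sorted_ltn_nth lt_trans x0 lt_s.
have [ys | nys] := boolP (y \in s); last first.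
  by apply: contraNF nys; apply: mem_take.
have lt_y : (index y s < size s)%N by rewrite index_mem.
rewrite in_take //= -{2}(nth_index x0 ys).
case: ltngtP => [lt_yj | lt_jy | ->]; last by rewrite lt_irr.
  by rewrite ltn_lt.
apply/esym/negP => lt_yj.
by have := lt_trans _ _ _ lt_yj (ltn_lt _ _ lt_j lt_y lt_jy); rewrite lt_irr.
Qed.

Theorem theorem2 (K : fieldType) (n : nat) (n_ge3 : (3 <= n)%N)
    (a : seq nat) (a_pos : forall b : nat, b \in a -> (0 < b)%N)
    (a_sum : sumn a = n)
    (ms : seq (triple n)) (ms_listing : block_listing a ms) :
  has_linear_quotients (@matching_field_ideal K n a)
    [seq monom K p | p <- ms].
Proof.
have [ms_perm ms_lt] := ms_listing; split=> [f | j].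
  by apply: eq_ideal_of; apply/perm_mem/perm_map; rewrite perm_sym.
rewrite size_map => lt_j; have [x0 _] : exists x, x \in ms.
  by case: (ms) lt_j => // x s _; exists x; rewrite mem_head.
have ms_gens p : (p \in ms) = (p \in matching_gens n a).
  by rewrite (perm_mem ms_perm) mem_enum.
have in_before p : (p \in take j ms) =
    (p \in matching_gens n a) && block_lt a p (nth x0 ms j).
  rewrite -ms_gens (mem_take_sorted x0 p (block_lt_irr a_sum)) //.
  exact: block_lt_trans.
rewrite (nth_map x0) // -map_take monomE (eq_map (@monomE K n)).
rewrite (map_comp (fun e => 'X_[K, e])).
apply: colon_generated_by_variables => _ /mapP[e + ->].
rewrite in_before => /andP[e_gen e_lt].
have [|v [lt_v [e' e'P le_e']]] := block_lt_exchange a_sum e_gen _ e_lt.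
  by rewrite -ms_gens mem_nth.
exists v; split=> //; exists (exponent e') => //.
by apply: map_f; rewrite in_before.
Qed.
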